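(* For every positive integer $k$ there exist constants $D_k\geq1$ and $B_k>0$, depending only on $k$, such that the following holds. For every positive integer $d$, every system $h_1,\dots,h_d$ of polynomials of degree at most $k$ with real coefficients and no constant term (i.e. $h_j(0)=0$), and every integer $N\geq1$, there exists an integer $1\leq n\leq N$ such that \[\|h_j(n)\|\leq B_k \exp\bigl(-(4^k k!\,D_k d^{5k})^{-1}(\log N)^{1/D_k}\bigr)\quad\text{for } j=1,\dots,d.\]
   Context: For $\alpha\in\mathbb R$, $\|\alpha\|$ denotes the distance from $\alpha$ to the nearest integer. *)

(* Defs.v *)
From Stdlib Require Import Reals.
Open Scope R_scope.

Definition dist_nearest_int (x : R) : R :=
  Rmin (frac_part x) (1 - frac_part x).

(* A real polynomial of degree at most k with no constant term,
   given by its coefficients c 1, ..., c k:  h(x) = sum_{i=1}^k c_i x^i. *)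
Definition poly_nc (k : nat) (c : nat -> R) (x : R) : R :=
  sum_f_R0 (fun i => c (S i) * x ^ (S i)) (pred k).

(* Main.v *)
(** By induction on [k] one shows that for every finite list [L] of reals and every [b] some
    [n <= 2 ^ poly(|L|, b)] makes all [c * n ^ e], [c] in [L], [1 <= e <= k], within [2 ^ -b] of
    integers. For the step to [K = k + 1], the case [k] yields integers [a_0, ..., a_{m-1}], chosen
    one after the other, such that every [c * a_{i_1} * ... * a_{i_l}] with [l <= K] is almost an
    integer, except the pure powers [c * a_i ^ K]; so modulo 1
      [c * (sum_i g_i * a_i) ^ K] is close to [sum_i g_i ^ K * c * a_i ^ K].
    The sunflower lemma, applied to the sets of indices whose sums of [a_i ^ K] fall in the same
    box modulo 1, provides polynomially many disjoint index sets [D_0, D_1, ...] whose sums [W_j] of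
    [a_i ^ K] satisfy [c * W_j ~ c * W_0] modulo 1. By Dirichlet there is [q >= 1] with [q * c * W_0]
    almost an integer, and writing [q = sum_j x_j ^ K] with [O(log q)] summands, the integer
    [n = sum_j x_j * sum_(i in D_j) a_i] works. Since [log n] stays polynomial in [|L|] and [b], the
    bound of the theorem follows by taking [b] as large as [N] allows. *)

Require Import Defs.
From Stdlib Require Import Reals Arith.
From Stdlib Require Import ZArith Lra Lia List ClassicalEpsilon.
From mathcomp Require all_boot.
Open Scope R_scope.

(** * Sunflowers and the pigeonhole principle *)

Module Sunflower.
Import all_boot.
Local Open Scope nat_scope.
Set Implicit Arguments.
Unset Strict Implicit.

(** Induction on the common size. Take a maximal disjoint subfamily [P]. If [P] has [s] members,
    they are petals with empty kernel. Otherwise [cover P] has at most [B] points and, by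
    maximality, meets every member of [F], so some point [u] lies in many members; delete [u] from
    these, apply induction and add [u] to the kernel. The separate bound [B] stays fixed while the
    size drops. *)
Lemma sunflower (T : finType) (s B t : nat) (F : {set {set T}}) :
  (forall A, A \in F -> #|A| = t) -> s * t <= B -> B ^ t < #|F| ->
  exists K : {set T}, exists D : nat -> {set T},
    [/\ forall i, i < s -> D i != set0,
        forall i j, i < s -> j < s -> i != j -> [disjoint D i & D j],
        forall i, i < s -> [disjoint K & D i]
      & forall i, i < s -> K :|: D i \in F].
Proof.
elim: t F => [|t IHt] F cardF sB ltF.
  have sF : F \subset [set set0].
    by apply/subsetP=> A /cardF/eqP; rewrite cards_eq0 inE.
  by have := leq_trans ltF (subset_leq_card sF); rewrite cards1 expn0 ltnn.
have t0 : trivIset (set0 : {set {set T}}) by apply/trivIsetP=> A B'; rewrite inE.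
have ex0 : (set0 \subset F) && trivIset (set0 : {set {set T}}) by rewrite sub0set t0.
have [P maxP _] := maxset_exists (P := fun P => (P \subset F) && trivIset P) ex0.
have /andP[sPF tP] := maxsetp maxP.
have neF A : A \in F -> A != set0 by move=> /cardF; rewrite -cards_eq0 => ->.
case: (leqP s #|P|) => [sP|Ps].
  exists set0, (fun i => nth set0 (enum P) i).
  have inP i : i < s -> nth set0 (enum P) i \in P.
    by move=> lis; rewrite -mem_enum mem_nth // -cardE (leq_trans lis).
  split=> [i lis|i j lis ljs nij|i lis|i lis].
  - by apply/neF/(subsetP sPF)/inP.
  - apply: (trivIsetP tP); rewrite ?inP //.
    by rewrite nth_uniq ?enum_uniq -?cardE ?(leq_trans lis) ?(leq_trans ljs).
  - by rewrite -setI_eq0 set0I.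
  - by rewrite set0U; apply/(subsetP sPF)/inP.
have meets A : A \in F -> exists2 u, u \in cover P & u \in A.
  move=> FA; apply/exists_inP; apply: contraT => /exists_inPn noA.
  have dis C : C \in P -> [disjoint A & C].
    move=> PC; rewrite -setI_eq0; apply/eqP/setP=> u; rewrite !inE.
    apply/negP=> /andP[Au Cu]; have : u \notin A; last by rewrite Au.
    by apply: noA; apply/bigcupP; exists C.
  have tA : (A |: P \subset F) && trivIset (A |: P).
    rewrite subUset sub1set FA sPF /=; apply/trivIsetP=> C D.
    rewrite !inE => /orP[/eqP->|PC] /orP[/eqP->|PD] nCD.
    - by rewrite eqxx in nCD.
    - exact: dis.
    - by rewrite disjoint_sym dis.
    - by apply: (trivIsetP tP).
  have eP : A |: P = P by apply: (maxsetsup maxP) => //; apply: subsetUr.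
  have PA : A \in P by rewrite -eP setU11.
  have := dis A PA; rewrite -setI_eq0 setIid => /eqP A0.
  by have := neF A FA; rewrite A0 eqxx.
have cardcov : #|cover P| <= B.
  apply: leq_trans sB; apply: leq_trans (leq_card_cover P) _.
  rewrite (eq_bigr (fun=> t.+1)) => [|A PA]; last by rewrite cardF ?(subsetP sPF).
  by rewrite sum_nat_const leq_mul2r (ltnW Ps) orbT.
have [u ubig] : exists u, B ^ t < #|[set A in F | u \in A]|.
  apply/existsP; apply: contraT => /existsPn small.
  have sF : F \subset \bigcup_(u in cover P) [set A in F | u \in A].
    apply/subsetP=> A FA; have [u Pu Au] := meets A FA.
    by apply/bigcupP; exists u; rewrite // inE FA.
  have : #|F| <= \sum_(u in cover P) B ^ t.
    apply: leq_trans (subset_leq_card sF) _.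
    apply: (@leq_trans (\sum_(u in cover P) #|[set A in F | u \in A]|)).
      elim/big_rec2: _ => [|i n A _ le]; first by rewrite cards0.
      by apply: leq_trans (leq_card_setU _ _) _; rewrite leq_add2l.
    by apply: leq_sum => u _; rewrite leqNgt small.
  rewrite sum_nat_const => le; have := leq_trans ltF le.
  by rewrite expnS ltnNge leq_mul2r cardcov orbT.
pose F' := [set A :\ u | A in [set A in F | u \in A]].
have cF' : #|F'| = #|[set A in F | u \in A]|.
  apply: card_in_imset => A C; rewrite !inE => /andP[_ uA] /andP[_ uC] eAC.
  by rewrite -(setD1K uA) eAC setD1K.
have [|||K [D [neD dD dK KD]]] := IHt F'.
- move=> A /imsetP[C]; rewrite inE => /andP[FC uC] ->.
  by have := cardF C FC; rewrite (cardsD1 u) uC add1n; case.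
- by apply: leq_trans sB; rewrite leq_mul2l leqnSn orbT.
- by rewrite cF'.
exists (u |: K), D; split=> // i lis;
  have /imsetP[C] := KD i lis; rewrite inE => /andP[FC uC] eC.
- rewrite -setI_eq0 setIUl (eqP (_ : K :&: D i == set0)) ?setU0 ?setI_eq0 ?dK //.
  rewrite disjoints1; apply/negP=> uD.
  have : u \in K :|: D i by rewrite inE uD orbT.
  by rewrite eC setD11.
- by rewrite -setUA eC setD1K.
Qed.

(** The falling factorial is a product of [t] factors running from [n + t - 1] down to [n]. *)
Lemma exp_le_ffact (n t : nat) : n ^ t <= (n + t).-1 ^_ t.
Proof.
elim: t => [|t IHt]; first by rewrite ffactn0.
rewrite ffactnS expnS addnS /=; case: n IHt => [|n] IHt //=.
by rewrite leq_mul // ?leq_addr.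
Qed.

Lemma fact_le_exp (t : nat) : t`! <= t ^ t.
Proof.
elim: t => [|t IHt] //; rewrite factS expnS leq_mul2l /=.
apply: leq_trans IHt _; case: t => [|t] //.
by rewrite leq_exp2r.
Qed.

(** The value of [m] makes the number of [t]-subsets exceed [q * (s * t) ^ t], so more than
    [(s * t) ^ t] of them share a code and contain a sunflower with kernel [K] and petals [D i]. *)
Lemma disjoint_sets_equal_codes (s t m q : nat) (code : (nat -> bool) -> nat) :
  0 < t -> m = 2 * s * t * t + t -> q <= 2 ^ t ->
  (forall A, code A < q) ->
  exists (K : nat -> bool) (D U : nat -> nat -> bool),
    [/\ forall i, i < s -> exists2 u, u < m & D i u,
        forall i j u, i < s -> j < s -> i <> j -> u < m -> D i u -> D j u = false,
        forall i u, i < s -> u < m -> K u -> D i u = false,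
        forall i u, i < s -> u < m -> U i u = K u || D i u
      & forall i, i < s -> code (U i) = code (U 0)].
Proof.
move=> t0 mE qt codeq.
(* Since [t] is positive, so is [m]; writing it as a successor makes [inord] available. *)
case: m mE => [|m] mE; first by rewrite addnC in mE; case: t t0 mE {qt}.
pose fn (A : {set 'I_m.+1}) (u : nat) := inord u \in A.
pose F c := [set A : {set 'I_m.+1} | (#|A| == t) && (code (fn A) == c)].
have [c ltc] : exists c : 'I_q, (s * t) ^ t < #|F c|.
  apply/existsP; apply: contraT => /existsPn small.
  have sub : [set A : {set 'I_m.+1} | #|A| == t] \subset \bigcup_(c < q) F c.
    apply/subsetP=> A; rewrite inE => cA; apply/bigcupP.
    by exists (Ordinal (codeq (fn A))); rewrite // inE cA /=.
  have : 'C(m.+1, t) <= \sum_(c < q) (s * t) ^ t.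
    rewrite -{1}(card_ord m.+1) -card_draws.
    apply: leq_trans (subset_leq_card sub) _.
    apply: (@leq_trans (\sum_(c < q) #|F c|)).
      elim/big_rec2: _ => [|i n A _ le]; first by rewrite cards0.
      by apply: leq_trans (leq_card_setU _ _) _; rewrite leq_add2l.
    by apply: leq_sum => c _; rewrite leqNgt small.
  rewrite sum_nat_const card_ord => le.
  have : m.+1 ^_ t <= (2 * s * t * t) ^ t.
    rewrite -bin_ffact; apply: leq_trans (leq_mul le (fact_le_exp t)) _.
    have -> : (2 * s * t * t) ^ t = 2 ^ t * (s * t) ^ t * t ^ t.
      by rewrite !expnMn !mulnA.
    by rewrite !leq_mul2r qt !orbT.
  (* Here [m.+1] equals [(2 * s * t * t).+1 + t - 1]; the extra unit makes the count strict. *)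
  have := exp_le_ffact (2 * s * t * t).+1 t; rewrite addSn -mE /= => le1 le2.
  have := leq_trans le1 le2; rewrite leqNgt ltn_exp2r //.
  by rewrite ltnSn.
have [|K [D [neD dD dK KD]]] := @sunflower _ s (s * t) t (F c) _ (leqnn _) ltc.
  by move=> A; rewrite inE => /andP[/eqP].
exists (fn K), (fun i => fn (D i)), (fun i => fn (K :|: D i)).
have dis (A C : {set 'I_m.+1}) u : [disjoint A & C] -> fn A u -> fn C u = false.
  by move=> dAC Au; apply: (disjointFr dAC).
split.
- move=> i lis; have /set0Pn[u uD] := neD i lis.
  by exists u; rewrite // /fn inord_val.
- by move=> i j u lis ljs /eqP nij _; apply/dis/dD.
- by move=> i u lis _; apply/dis/dK.
- by move=> i u _ _; rewrite /fn inE.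
- move=> i lis; have := KD i lis; rewrite inE => /andP[_ /eqP->].
  by have := KD 0 (leq_ltn_trans (leq0n i) lis); rewrite inE => /andP[_ /eqP->].
Qed.

Lemma pigeonhole (n : nat) (f : nat -> nat) :
  (forall i, f i < n) -> exists i j, [/\ i < j, j <= n & f i = f j].
Proof.
move=> ltf; pose g (i : 'I_n.+1) := Ordinal (ltf i).
have /injectivePn[i [j nij eij]] : ~~ injectiveb g.
  by apply/negP=> /injectiveP/leq_card; rewrite !card_ord ltnn.
have {}eij : f i = f j by case: eij.
case: (ltngtP i j) => [lij|lji|/ord_inj eq].
- by exists i, j; split=> //; rewrite -ltnS.
- by exists j, i; split=> //; rewrite -ltnS.
- by rewrite eq eqxx in nij.
Qed.

Lemma expn_pow (a n : nat) : a ^ n = Nat.pow a n.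
Proof. by elim: n => [|n IHn] //=; rewrite expnS IHn. Qed.

(** Transfer to the order and power of the standard library, as used in the analytic part. *)
Lemma disjoint_sets_equal_codes_nat (s t q : nat) (code : (nat -> bool) -> nat) :
  let m := Nat.add (Nat.mul (Nat.mul (Nat.mul 2 s) t) t) t in
  (0 < t)%coq_nat -> (q <= Nat.pow 2 t)%coq_nat ->
  (forall A, (code A < q)%coq_nat) ->
  exists (K : nat -> bool) (D U : nat -> nat -> bool),
    (forall i, (i < s)%coq_nat -> exists u, (u < m)%coq_nat /\ D i u = true) /\
    (forall i j u, (i < s)%coq_nat -> (j < s)%coq_nat -> i <> j -> (u < m)%coq_nat ->
       D i u = true -> D j u = false) /\
    (forall i u, (i < s)%coq_nat -> (u < m)%coq_nat -> K u = true -> D i u = false) /\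
    (forall i u, (i < s)%coq_nat -> (u < m)%coq_nat -> U i u = orb (K u) (D i u)) /\
    (forall i, (i < s)%coq_nat -> code (U i) = code (U 0)).
Proof.
move=> m /ltP t0 /leP qt codeq.
have [||K [D [U [h1 h2 h3 h4 h5]]]] :=
  @disjoint_sets_equal_codes s t m q code t0 (erefl _).
- by rewrite expn_pow.
- by move=> A; apply/ltP.
exists K, D, U; split; [|split; [|split; [|split]]].
- by move=> i /ltP/h1[u /ltP um Du]; exists u.
- by move=> i j u /ltP si /ltP sj nij /ltP um; apply: h2.
- by move=> i u /ltP si /ltP um; apply: h3.
- by move=> i u /ltP si /ltP um; apply: h4.
- by move=> i /ltP; apply: h5.
Qed.

Lemma pigeonhole_nat (n : nat) (f : nat -> nat) :
  (forall i, (f i < n)%coq_nat) ->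
  exists i j, (i < j)%coq_nat /\ (j <= n)%coq_nat /\ f i = f j.
Proof.
move=> ltf; have [|i [j [/ltP ? /leP ? ?]]] := @pigeonhole n f.
  by move=> i; apply/ltP.
by exists i, j.
Qed.
End Sunflower.

(** * Almost-integers *)

(** An explicit integer witness lets errors add under sums and scale under integer multiples, with
    no case analysis on [frac_part]. *)
Definition near (e x : R) : Prop := exists z : Z, Rabs (x - IZR z) <= e.

Lemma near_le (e f x : R) : near e x -> e <= f -> near f x.
Proof. intros [z H] Hef; exists z; lra. Qed.

Lemma near_zero (e : R) : 0 <= e -> near e 0.
Proof. intros He; exists 0%Z; rewrite Rminus_0_r, Rabs_R0; exact He. Qed.

Lemma near_add (e f x y : R) : near e x -> near f y -> near (e + f) (x + y).
Proof.
  intros [z Hz] [w Hw]; exists (z + w)%Z; rewrite plus_IZR.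
  replace (x + y - (IZR z + IZR w)) with ((x - IZR z) + (y - IZR w)) by ring.
  eapply Rle_trans; [apply Rabs_triang | lra].
Qed.

Lemma near_nat_mul (n : nat) (e x : R) : near e x -> near (INR n * e) (INR n * x).
Proof.
  intros [z Hz]; exists (Z.of_nat n * z)%Z; rewrite mult_IZR, <- INR_IZR_INZ.
  replace (INR n * x - INR n * IZR z) with (INR n * (x - IZR z)) by ring.
  rewrite Rabs_mult, (Rabs_pos_eq (INR n)) by apply pos_INR.
  apply Rmult_le_compat_l; [apply pos_INR | exact Hz].
Qed.

(** An integer [z] is either at most the floor of [x] or at least the floor plus one; the side
    decides which argument of [Rmin] is bounded. *)
Lemma dist_nearest_int_le_near (e x : R) : near e x -> dist_nearest_int x <= e.
Proof.
  intros [z Hz]; unfold dist_nearest_int, frac_part.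
  destruct (base_Int_part x) as [H1 H2].
  destruct (Z_le_gt_dec z (Int_part x)) as [h|h].
  - apply IZR_le in h; eapply Rle_trans; [apply Rmin_l|].
    pose proof (Rle_abs (x - IZR z)); lra.
  - assert (h' : (Int_part x + 1 <= z)%Z) by lia.
    apply IZR_le in h'; rewrite plus_IZR in h'.
    eapply Rle_trans; [apply Rmin_r|].
    pose proof (Rle_abs (- (x - IZR z))); rewrite Rabs_Ropp in *; lra.
Qed.

Lemma dist_nearest_int_le_half (x : R) : dist_nearest_int x <= 1 / 2.
Proof.
  unfold dist_nearest_int.
  pose proof (Rmin_l (frac_part x) (1 - frac_part x)).
  pose proof (Rmin_r (frac_part x) (1 - frac_part x)); lra.
Qed.

(** * Finite sums *)

Fixpoint rsum (f : nat -> R) (n : nat) : R :=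
  match n with O => 0 | S n => rsum f n + f n end.

Fixpoint nsum (f : nat -> nat) (n : nat) : nat :=
  match n with O => 0 | S n => nsum f n + f n end%nat.

Lemma rsum_ext (f g : nat -> R) (n : nat) :
  (forall u, (u < n)%nat -> f u = g u) -> rsum f n = rsum g n.
Proof.
  induction n as [|n IH]; intros H; simpl; [reflexivity|].
  rewrite IH, H by (intros; try apply H; lia); reflexivity.
Qed.

Lemma rsum_add (f g : nat -> R) (n : nat) :
  rsum (fun u => f u + g u) n = rsum f n + rsum g n.
Proof. induction n as [|n IH]; simpl; [ring | rewrite IH; ring]. Qed.

Lemma rsum_scal (r : R) (f : nat -> R) (n : nat) :
  rsum (fun u => r * f u) n = r * rsum f n.
Proof. induction n as [|n IH]; simpl; [ring | rewrite IH; ring]. Qed.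

Lemma rsum_swap (f : nat -> nat -> R) (m n : nat) :
  rsum (fun u => rsum (f u) n) m = rsum (fun i => rsum (fun u => f u i) m) n.
Proof.
  induction m as [|m IH]; simpl.
  - induction n as [|n IHn]; simpl; [reflexivity | rewrite <- IHn; ring].
  - rewrite IH, rsum_add; reflexivity.
Qed.

Lemma INR_nsum (f : nat -> nat) (n : nat) : INR (nsum f n) = rsum (fun u => INR (f u)) n.
Proof. induction n as [|n IH]; simpl; [reflexivity | rewrite plus_INR, IH; reflexivity]. Qed.

Lemma nsum_le (f g : nat -> nat) (n : nat) :
  (forall u, (u < n)%nat -> (f u <= g u)%nat) -> (nsum f n <= nsum g n)%nat.
Proof.
  induction n as [|n IH]; intros H; simpl; [lia|].
  assert (f n <= g n)%nat by (apply H; lia).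
  assert (nsum f n <= nsum g n)%nat by (apply IH; intros; apply H; lia); lia.
Qed.

Lemma nsum_le_const (f : nat -> nat) (n B : nat) :
  (forall u, (u < n)%nat -> (f u <= B)%nat) -> (nsum f n <= n * B)%nat.
Proof.
  induction n as [|n IH]; intros H; simpl; [lia|].
  assert (f n <= B)%nat by (apply H; lia).
  assert (nsum f n <= n * B)%nat by (apply IH; intros; apply H; lia); lia.
Qed.

Lemma nsum_ge_term (f : nat -> nat) (n u : nat) : (u < n)%nat -> (f u <= nsum f n)%nat.
Proof.
  induction n as [|n IH]; intros H; simpl; [lia|].
  destruct (Nat.eq_dec u n) as [->|]; [lia|].
  assert (f u <= nsum f n)%nat by (apply IH; lia); lia.
Qed.

Lemma near_weighted_sum (g : nat -> nat) (x : nat -> R) (e : R) (t : nat) :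
  (forall u, (u < t)%nat -> near e (x u)) ->
  near (INR (nsum g t) * e) (rsum (fun u => INR (g u) * x u) t).
Proof.
  induction t as [|t IH]; intros H; simpl.
  - apply near_zero; lra.
  - rewrite plus_INR, Rmult_plus_distr_r.
    apply near_add; [apply IH; intros; apply H; lia | apply near_nat_mul, H; lia].
Qed.

(** * Powers of a linear combination modulo 1 *)

Definition multiples (A L : list R) : list R := flat_map (fun b => map (Rmult b) A) L.

(** Products of an element of [L] with exactly [r] factors from [A]; having [1] in [A] also covers
    fewer factors. *)
Definition prods (A L : list R) (r : nat) : list R := Nat.iter r (multiples A) L.

Lemma in_prods_mul (A L : list R) (r : nat) (b a : R) :
  In b (prods A L r) -> In a A -> In (b * a) (prods A L (S r)).
Proof.
  intros Hb Ha; apply in_flat_map; exists b; split; [exact Hb | now apply in_map].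
Qed.

Lemma in_prods_base (A L : list R) (r : nat) (b : R) :
  In 1 A -> In b L -> In b (prods A L r).
Proof.
  intros H1 Hb; induction r as [|r IH]; [exact Hb|].
  rewrite <- (Rmult_1_r b); now apply in_prods_mul.
Qed.

Lemma length_prods (A L : list R) (r : nat) :
  length (prods A L r) = (length L * length A ^ r)%nat.
Proof.
  assert (H : forall M, length (multiples A M) = (length M * length A)%nat).
  { induction M as [|b M IH]; simpl; [reflexivity|].
    now rewrite length_app, length_map; fold (multiples A M); rewrite IH. }
  induction r as [|r IH]; simpl; [lia|].
  change (prods A L (S r)) with (multiples A (prods A L r)).
  rewrite H, IH; simpl; ring.
Qed.

Section Expansion.

Variables (k m : nat) (L : list R) (eps : R) (a : nat -> nat) (A : nat -> list R).
Hypothesis eps_pos : 0 <= eps.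
Hypothesis A_one : forall t, In 1 (A t).
Hypothesis A_old : forall u t, (u < t)%nat -> In (INR (a u)) (A t).
Hypothesis a_spec : forall t, (t < m)%nat ->
  forall b, In b (prods (A t) L k) -> forall e, (1 <= e <= k)%nat ->
  near eps (b * INR (a t) ^ e).

Variable g : nat -> nat.

Let lin (t : nat) : R := rsum (fun u => INR (g u) * INR (a u)) t.
Let wt (t : nat) : R := INR (nsum g t).

(** Expanding one factor [lin t] at a time replaces [b] by the products [b * INR (a u)], each using
    up one of the [k] factors that [prods] allows, and multiplies the error by the total weight
    [wt t]. When no factor is left, [a_spec] applies. *)
Lemma near_mixed (t e r : nat) (b : R) :
  (t < m)%nat -> (1 <= e <= k)%nat -> (r <= k)%nat ->
  In b (prods (A t) L (k - r)) ->
  near (wt t ^ r * eps) (b * lin t ^ r * INR (a t) ^ e).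
Proof.
  intros Ht He; revert b; induction r as [|r IH]; intros b Hr Hb.
  - rewrite Nat.sub_0_r in Hb; rewrite !pow_O, Rmult_1_l, Rmult_1_r.
    now apply a_spec.
  - assert (Hs : near (wt t * (wt t ^ r * eps))
      (rsum (fun u => INR (g u) * (b * INR (a u) * lin t ^ r * INR (a t) ^ e)) t)).
    { apply near_weighted_sum; intros u Hu; apply IH; [lia|].
      replace (k - r)%nat with (S (k - S r)) by lia.
      apply in_prods_mul; auto. }
    replace (b * lin t ^ S r * INR (a t) ^ e)
      with (rsum (fun u => INR (g u) * (b * INR (a u) * lin t ^ r * INR (a t) ^ e)) t).
    + eapply near_le; [exact Hs | simpl; lra].
    + rewrite (rsum_ext _ (fun u => (b * lin t ^ r * INR (a t) ^ e)
        * (INR (g u) * INR (a u)))) by (intros; ring).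
      rewrite rsum_scal; unfold lin; simpl; ring.
Qed.

(* The induction on l multiplies the cross terms of (y + z)^l by y + z, which is why
   the factor y^i a^j has to be carried along. *)
Lemma near_cross (t : nat) (b : R) (l i j : nat) :
  (t < m)%nat -> In b L -> (1 <= l)%nat -> (i + j + l <= S k)%nat ->
  near (((wt t + INR (g t)) ^ l - wt t ^ l - INR (g t) ^ l) * wt t ^ i * eps)
    (b * lin t ^ i * INR (a t) ^ j *
      ((lin t + INR (g t) * INR (a t)) ^ l - lin t ^ l - (INR (g t) * INR (a t)) ^ l)).
Proof.
  intros Ht Hb Hl; revert i j; induction l as [|l IH]; [lia|]; intros i j Hij.
  destruct l as [|l].
  - replace (b * _ * _ * _) with 0 by (simpl; ring).
    apply near_zero; apply Req_le; simpl; ring.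
  - specialize (IH ltac:(lia)).
    (* With [y = lin t] and [z = INR (g t) * INR (a t)], the cross terms at exponent [S (S l)] are
       [(y + z)] times those at [S l], plus [y * z ^ S l + y ^ S l * z]. [H1] and [H2] handle the
       first product, [H3] and [H4] the last two terms. *)
    assert (Hin : forall r, In b (prods (A t) L r)) by (intros; now apply in_prods_base).
    pose proof (IH (S i) j ltac:(lia)) as H1.
    pose proof (near_nat_mul (g t) _ _ (IH i (S j) ltac:(lia))) as H2.
    pose proof (near_nat_mul (g t ^ S l) _ _
      (near_mixed t (j + S l) (S i) b Ht ltac:(lia) ltac:(lia) (Hin _))) as H3.
    pose proof (near_nat_mul (g t) _ _
      (near_mixed t (S j) (i + S l) b Ht ltac:(lia) ltac:(lia) (Hin _))) as H4.
    pose proof (near_add _ _ _ _ (near_add _ _ _ _ H1 H2) (near_add _ _ _ _ H3 H4)) as H.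
    rewrite pow_INR in H.
    match type of H with near ?e ?x => match goal with |- near ?e' ?x' =>
      replace x' with x; [apply (near_le e); [exact H | apply Req_le]|] end end.
    + rewrite !pow_add; simpl; ring.
    + rewrite !pow_add, !Rpow_mult_distr; simpl; ring.
Qed.

(** Adding the index [t] creates cross terms and the pure power of [a t]; for exponents up to [k]
    both are almost integers. *)
Lemma near_lower (t : nat) (b : R) (l : nat) :
  (t <= m)%nat -> In b L -> (1 <= l <= k)%nat -> near (wt t ^ l * eps) (b * lin t ^ l).
Proof.
  intros Ht Hb Hl; induction t as [|t IH].
  - unfold lin, wt; simpl; rewrite !pow_i by lia; rewrite Rmult_0_r.
    apply near_zero; lra.
  - pose proof (near_cross t b l 0 0 ltac:(lia) Hb ltac:(lia) ltac:(lia)) as H1.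
    pose proof (near_nat_mul (g t ^ l) _ _
      (a_spec t ltac:(lia) b (in_prods_base _ _ _ _ (A_one t) Hb) l Hl)) as H2.
    pose proof (near_add _ _ _ _ (near_add _ _ _ _ (IH ltac:(lia)) H1) H2) as H.
    rewrite pow_INR in H.
    unfold lin, wt in *; cbn [nsum rsum]; rewrite plus_INR.
    match type of H with near ?e ?x => match goal with |- near ?e' ?x' =>
      replace x' with x; [apply (near_le e); [exact H | apply Req_le]|] end end.
    + simpl; ring.
    + rewrite !Rpow_mult_distr; simpl; ring.
Qed.

(** At exponent [S k] the pure powers are beyond the reach of [a_spec], so they are subtracted and
    only cross terms contribute. *)
Lemma near_top (t : nat) (b : R) :
  (t <= m)%nat -> In b L ->
  near (wt t ^ S k * eps)
    (b * lin t ^ S k - b * rsum (fun u => INR (g u) ^ S k * INR (a u) ^ S k) t).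
Proof.
  intros Ht Hb; induction t as [|t IH].
  - unfold lin, wt; cbn [nsum rsum]; rewrite !pow_i by lia.
    rewrite !Rmult_0_r, Rmult_0_l, Rminus_0_r; apply near_zero; simpl; lra.
  - pose proof (near_cross t b (S k) 0 0 ltac:(lia) Hb ltac:(lia) ltac:(lia)) as H1.
    pose proof (near_add _ _ _ _ (IH ltac:(lia)) H1) as H.
    unfold lin, wt in *; cbn [nsum rsum]; rewrite plus_INR.
    match type of H with near ?e ?x => match goal with |- near ?e' ?x' =>
      replace x' with x; [apply (near_le e); [exact H |]|] end end.
    + rewrite !pow_O.
      pose proof (pow_le (INR (g t)) (S k) (pos_INR _)).
      assert (0 <= INR (g t) ^ S k * eps) by (apply Rmult_le_pos; assumption).
      lra.
    + rewrite (Rpow_mult_distr (INR (g t))); rewrite !pow_O; ring.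
Qed.

End Expansion.

(** * Boxes modulo 1, Dirichlet approximation and sums of powers *)

Definition digit (b : nat) (x : R) : nat := Z.to_nat (Int_part (2 ^ b * frac_part x)).

Lemma IZR_digit (b : nat) (x : R) :
  IZR (Z.of_nat (digit b x)) = IZR (Int_part (2 ^ b * frac_part x)).
Proof.
  unfold digit; rewrite Z2Nat.id; [reflexivity|].
  destruct (base_fp x) as [H0 _].
  assert (0 <= 2 ^ b * frac_part x) by (apply Rmult_le_pos; [apply pow_le|]; lra).
  destruct (base_Int_part (2 ^ b * frac_part x)) as [_ H2].
  assert (H3 : IZR (-1) < IZR (Int_part (2 ^ b * frac_part x))) by lra.
  apply lt_IZR in H3; lia.
Qed.

Lemma digit_lt (b : nat) (x : R) : (digit b x < 2 ^ b)%nat.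
Proof.
  apply INR_lt; rewrite pow_INR, INR_IZR_INZ, IZR_digit.
  destruct (base_fp x) as [_ H1].
  destruct (base_Int_part (2 ^ b * frac_part x)) as [H2 _].
  assert (0 < 2 ^ b) by (apply pow_lt; lra).
  replace (INR 2) with 2 by (simpl; ring); nra.
Qed.

Lemma digit_eq_near (b : nat) (x y : R) :
  digit b x = digit b y -> near (/ 2 ^ b) (x - y).
Proof.
  intros H.
  assert (H' : IZR (Int_part (2 ^ b * frac_part x)) = IZR (Int_part (2 ^ b * frac_part y)))
    by now rewrite <- !IZR_digit, H.
  exists (Int_part x - Int_part y)%Z; rewrite minus_IZR.
  replace (x - y - (IZR (Int_part x) - IZR (Int_part y)))
    with (frac_part x - frac_part y) by (unfold frac_part; ring).
  destruct (base_Int_part (2 ^ b * frac_part x)) as [H1 H2].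
  destruct (base_Int_part (2 ^ b * frac_part y)) as [H3 H4].
  assert (Hp : 0 < 2 ^ b) by (apply pow_lt; lra).
  apply (Rmult_le_reg_l (2 ^ b)); [exact Hp|].
  rewrite Rinv_r by lra.
  rewrite <- (Rabs_pos_eq (2 ^ b)) by lra; rewrite <- Rabs_mult.
  apply Rabs_le; lra.
Qed.

(** The box of the point [(c * x)], [c] in [L], of the torus, packed into one number in base [2 ^ b]
    so that it can serve as a pigeonhole code. *)
Fixpoint cell (b : nat) (L : list R) (x : R) : nat :=
  match L with
  | nil => 0
  | c :: L => digit b (c * x) + 2 ^ b * cell b L x
  end%nat.

Lemma cell_lt (b : nat) (L : list R) (x : R) : (cell b L x < 2 ^ (b * length L))%nat.
Proof.
  induction L as [|c L IH]; simpl.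
  - rewrite Nat.mul_0_r; simpl; lia.
  - rewrite Nat.mul_succ_r, Nat.add_comm, Nat.pow_add_r, Nat.add_comm.
    pose proof (digit_lt b (c * x)); nia.
Qed.

Lemma radix_unique (Q u v x y : nat) :
  (u < Q)%nat -> (v < Q)%nat -> (u + Q * x = v + Q * y)%nat -> u = v /\ x = y.
Proof.
  intros Hu Hv H; destruct (Nat.lt_trichotomy x y) as [h|[h|h]]; [nia| |nia].
  subst y; lia.
Qed.

Lemma cell_eq_near (b : nat) (L : list R) (x y : R) :
  cell b L x = cell b L y -> forall c, In c L -> near (/ 2 ^ b) (c * x - c * y).
Proof.
  induction L as [|c' L IH]; simpl; intros H c Hc; [contradiction|].
  apply radix_unique in H; [|apply digit_lt|apply digit_lt].
  destruct H as [H1 H2], Hc as [<-|Hc]; [now apply digit_eq_near | now apply IH].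
Qed.

(** Among the multiples of [x] by [0, ..., 2 ^ (b * length L)] two share a cell; [q] is the
    difference of their indices. *)
Lemma dirichlet (b : nat) (L : list R) (x : R) :
  exists q : nat, (1 <= q <= 2 ^ (b * length L))%nat /\
    forall c, In c L -> near (/ 2 ^ b) (INR q * (c * x)).
Proof.
  destruct (@Sunflower.pigeonhole_nat (2 ^ (b * length L))%nat (fun q => cell b L (INR q * x)))
    as [i [j [Hij [Hj Heq]]]]; [intros; apply cell_lt|].
  exists (j - i)%nat; split; [lia|]; intros c Hc.
  rewrite minus_INR by lia.
  replace ((INR j - INR i) * (c * x)) with (c * (INR j * x) - c * (INR i * x)) by ring.
  now apply (cell_eq_near b L).
Qed.

(* Base 2^K expansion: a digit r at place i contributes r copies of (2^i)^K. *)
Lemma sum_of_few_powers (K w q : nat) :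
  (q < 2 ^ (K * w))%nat ->
  exists c : nat -> nat, exists s : nat, (s <= 2 ^ K * w)%nat /\
    (forall i, (i < s)%nat -> (1 <= c i)%nat) /\ nsum (fun i => c i ^ K)%nat s = q.
Proof.
  revert q; induction w as [|w IH]; intros q Hq.
  - rewrite Nat.mul_0_r in Hq; simpl in Hq.
    exists (fun _ => 1%nat), 0%nat; simpl; repeat split; lia.
  - assert (H0 : (2 ^ K <> 0)%nat) by (apply Nat.pow_nonzero; lia).
    rewrite Nat.mul_succ_r, Nat.pow_add_r in Hq.
    destruct (IH (q / 2 ^ K)%nat) as [c [s [Hs [Hc Hsum]]]].
    { apply Nat.Div0.div_lt_upper_bound; lia. }
    pose proof (Nat.div_mod q (2 ^ K) H0) as Hdm.
    pose proof (Nat.mod_upper_bound q (2 ^ K) H0) as Hm.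
    exists (fun i => if i <? s then 2 * c i else 1)%nat, (s + q mod 2 ^ K)%nat.
    repeat split; [lia| |].
    + intros i Hi; destruct (Nat.ltb_spec i s); [specialize (Hc i H)|]; lia.
    + transitivity (2 ^ K * nsum (fun i => c i ^ K)%nat s + q mod 2 ^ K)%nat;
        [|rewrite Hsum; lia].
      generalize (q mod 2 ^ K)%nat as r; clear.
      assert (H : forall n, (n <= s)%nat ->
        nsum (fun i => (if i <? s then 2 * c i else 1) ^ K)%nat n
        = (2 ^ K * nsum (fun i => c i ^ K)%nat n)%nat).
      { induction n as [|n IH]; intros Hn; cbn [nsum]; [lia|].
        rewrite IH by lia; destruct (Nat.ltb_spec n s); [|lia].
        rewrite Nat.pow_mul_l; lia. }
      induction r as [|r IH].
      * rewrite !Nat.add_0_r; apply H; lia.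
      * rewrite Nat.add_succ_r; cbn [nsum]; rewrite IH.
        destruct (Nat.ltb_spec (s + r) s); [lia|].
        rewrite Nat.pow_1_l; lia.
Qed.

Definition chi (b : bool) : nat := if b then 1 else 0.

(** At most one summand is nonzero, so there are no cross terms. *)
Lemma pow_disjoint_combination (c : nat -> nat) (D : nat -> bool) (K s : nat) :
  (1 <= K)%nat ->
  (forall i j, (i < s)%nat -> (j < s)%nat -> i <> j -> D i = true -> D j = false) ->
  (nsum (fun i => c i * chi (D i))%nat s ^ K = nsum (fun i => c i ^ K * chi (D i))%nat s)%nat.
Proof.
  intros HK; induction s as [|s IH]; intros HD; simpl; [apply Nat.pow_0_l; lia|].
  rewrite <- IH by (intros; apply (HD i j); auto with arith).
  destruct (D s) eqn:Es; simpl.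
  - assert (H0 : nsum (fun i => c i * chi (D i))%nat s = 0%nat).
    { apply Nat.le_0_r; rewrite <- (Nat.mul_0_r s).
      apply nsum_le_const; intros u Hu.
      rewrite (HD s u) by (lia || assumption); simpl; lia. }
    rewrite H0, Nat.pow_0_l, !Nat.mul_1_r by lia; reflexivity.
  - now rewrite !Nat.mul_0_r, !Nat.add_0_r.
Qed.

(** * Polynomial bounds *)

(** Since the base is at least 2, constant factors and sums are absorbed by a larger exponent. *)
Definition poly_bounded (f : nat -> nat -> nat) : Prop :=
  exists e, forall d b, (f d b <= (d + b + 2) ^ e)%nat.

Lemma pow_le_pow_add (X e f : nat) : (2 <= X)%nat -> (X ^ e <= X ^ (e + f))%nat.
Proof. intros; apply Nat.pow_le_mono_r; lia. Qed.

Lemma poly_bounded_const (c : nat) : poly_bounded (fun _ _ => c).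
Proof.
  exists c; intros d b; transitivity (2 ^ c)%nat.
  - apply Nat.lt_le_incl, Nat.pow_gt_lin_r; lia.
  - apply Nat.pow_le_mono_l; lia.
Qed.

Lemma poly_bounded_fst : poly_bounded (fun d _ => d).
Proof. exists 1%nat; intros; simpl; lia. Qed.

Lemma poly_bounded_snd : poly_bounded (fun _ b => b).
Proof. exists 1%nat; intros; simpl; lia. Qed.

Lemma poly_bounded_mul (f g : nat -> nat -> nat) :
  poly_bounded f -> poly_bounded g -> poly_bounded (fun d b => f d b * g d b)%nat.
Proof.
  intros [e He] [e' He']; exists (e + e')%nat; intros d b.
  rewrite Nat.pow_add_r; now apply Nat.mul_le_mono.
Qed.

Lemma poly_bounded_add (f g : nat -> nat -> nat) :
  poly_bounded f -> poly_bounded g -> poly_bounded (fun d b => f d b + g d b)%nat.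
Proof.
  intros [e He] [e' He']; exists (S (e + e')); intros d b.
  specialize (He d b); specialize (He' d b).
  pose proof (pow_le_pow_add (d + b + 2) e e' ltac:(lia)).
  pose proof (pow_le_pow_add (d + b + 2) e' e ltac:(lia)).
  rewrite (Nat.add_comm e' e) in *; simpl; nia.
Qed.

Lemma poly_bounded_pow (f : nat -> nat -> nat) (n : nat) :
  poly_bounded f -> poly_bounded (fun d b => f d b ^ n)%nat.
Proof.
  intros [e He]; exists (e * n)%nat; intros d b.
  rewrite Nat.pow_mul_r; now apply Nat.pow_le_mono_l.
Qed.

Lemma pow2_INR (n : nat) : INR (2 ^ n) = 2 ^ n.
Proof. rewrite pow_INR; reflexivity. Qed.

Lemma pow2_inv_antitone (m n : nat) : (m <= n)%nat -> / 2 ^ n <= / 2 ^ m.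
Proof.
  intros H; apply Rinv_le_contravar; [apply pow_lt; lra | apply Rle_pow; [lra|exact H]].
Qed.

(** * Induction on the degree *)

Definition recurrence (k E : nat) : Prop :=
  forall (L : list R) (b : nat), exists n : nat,
    (1 <= n <= 2 ^ ((length L + b + 2) ^ E))%nat /\
    forall c, In c L -> forall e, (1 <= e <= k)%nat -> near (/ 2 ^ b) (c * INR n ^ e).

(** The choice of [a t] treats all coefficients multiplied by up to [k] earlier terms; there are
    [length L * S t ^ k] such products, which explains [S m ^ k] in the bound. *)
Lemma recurrence_sequence (k E : nat) (L : list R) (b m : nat) :
  recurrence k E ->
  exists (a : nat -> nat) (A : nat -> list R),
    (forall t, In 1 (A t)) /\
    (forall u t, (u < t)%nat -> In (INR (a u)) (A t)) /\
    forall t, (t < m)%nat ->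
      (1 <= a t <= 2 ^ ((length L * S m ^ k + b + 2) ^ E))%nat /\
      forall c, In c (prods (A t) L k) -> forall e, (1 <= e <= k)%nat ->
      near (/ 2 ^ b) (c * INR (a t) ^ e).
Proof.
  intros HP.
  destruct (choice (fun M n => (1 <= n <= 2 ^ ((length M + b + 2) ^ E))%nat /\
    forall c, In c M -> forall e, (1 <= e <= k)%nat -> near (/ 2 ^ b) (c * INR n ^ e))
    (fun M => HP M b)) as [f Hf].
  pose (A := fix A (t : nat) : list R := match t with
    | O => 1 :: nil
    | S t => INR (f (prods (A t) L k)) :: A t end).
  assert (Hlen : forall t, length (A t) = S t)
    by (induction t as [|t IH]; simpl; [|rewrite IH]; reflexivity).
  exists (fun t => f (prods (A t) L k)), A; split; [|split].
  - induction t as [|t IH]; simpl; auto.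
  - intros u t Hut; induction t as [|t IH]; [lia|].
    destruct (Nat.eq_dec u t) as [->|]; simpl; [now left | right; apply IH; lia].
  - intros t Ht; destruct (Hf (prods (A t) L k)) as [[H1 H2] H3].
    split; [split; [exact H1|]|exact H3].
    etransitivity; [exact H2|].
    apply Nat.pow_le_mono_r; [lia|]; apply Nat.pow_le_mono_l.
    rewrite length_prods, Hlen.
    assert (S t ^ k <= S m ^ k)%nat by (apply Nat.pow_le_mono_l; lia); nia.
Qed.

(** Here [2 ^ p] bounds the Dirichlet multiplier [q], [s] bounds the number of [K]-th powers summing
    to [q], and [t] exceeds the bits of a cell of precision [p + (b + 2)], the [p] paying for
    multiplication by [q]. The ground set has size [m], and [b'] pays for the [K]-th power of the
    total weight, at most [2 ^ (m + p)]. *)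
Lemma recurrence_step (k E : nat) (L : list R) (b : nat) :
  recurrence k E ->
  let d := length L in
  let K := S k in
  let p := ((b + 2) * d)%nat in
  let t := ((p + (b + 2)) * d + 1)%nat in
  let s := (2 ^ K * (p + 1))%nat in
  let m := (2 * s * t * t + t)%nat in
  let b' := (K * (m + p) + (b + 2))%nat in
  exists n : nat,
    (1 <= n <= 2 ^ (2 * m + p + (d * S m ^ k + b' + 2) ^ E))%nat /\
    forall c, In c L -> forall e, (1 <= e <= K)%nat -> near (/ 2 ^ b) (c * INR n ^ e).
Proof.
  intros HP d K p t s m b'.
  assert (Ep : p = ((b + 2) * d)%nat) by reflexivity.
  assert (Et : t = ((p + (b + 2)) * d + 1)%nat) by reflexivity.
  assert (Es : s = (2 ^ K * (p + 1))%nat) by reflexivity.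
  assert (Em : m = (2 * s * t * t + t)%nat) by reflexivity.
  assert (Eb : b' = (K * (m + p) + (b + 2))%nat) by reflexivity.
  clearbody b' m s t p.
  destruct (recurrence_sequence k E L b' m HP) as [a [A [HA1 [HA2 HA3]]]].
  pose (W := fun U : nat -> bool => rsum (fun u => INR (chi (U u)) * INR (a u) ^ K) m).
  pose proof (@Sunflower.disjoint_sets_equal_codes_nat s t (2 ^ ((p + (b + 2)) * d))%nat
    (fun U => cell (p + (b + 2)) L (W U))) as HD.
  cbv zeta in HD; rewrite <- Em in HD.
  destruct HD as [Ker [D [U [HD1 [HD2 [HD3 [HD4 HD5]]]]]]].
  { lia. }
  { apply Nat.pow_le_mono_r; lia. }
  { intros; apply cell_lt. }
  clear Em Et.
  (* The kernel contributes the same amount to every [U i] and cancels in differences. *)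
  assert (HW : forall i, (i < s)%nat -> W (U i) = W Ker + W (D i)).
  { intros i Hi; unfold W; rewrite <- rsum_add; apply rsum_ext; intros u Hu.
    rewrite HD4 by assumption; destruct (Ker u) eqn:EK; simpl.
    - rewrite (HD3 i u) by assumption; simpl; ring.
    - ring. }
  assert (Hs : (1 <= s)%nat).
  { rewrite Es; apply Nat.neq_0_lt_0, Nat.neq_mul_0; split;
      [apply Nat.pow_nonzero|]; lia. }
  assert (HWD : forall i c, (i < s)%nat -> In c L ->
    near (/ 2 ^ (p + (b + 2))) (c * W (D i) - c * W (D 0%nat))).
  { intros i c Hi Hc; pose proof (cell_eq_near _ _ _ _ (HD5 i Hi) c Hc) as H.
    rewrite !HW in H by lia.
    replace (c * W (D i) - c * W (D 0%nat))
      with (c * (W Ker + W (D i)) - c * (W Ker + W (D 0%nat))) by ring.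
    exact H. }
  destruct (dirichlet (b + 2) L (W (D 0%nat))) as [q [[Hq1 Hq2] Hq]].
  fold d in Hq2; rewrite <- Ep in Hq2.
  destruct (sum_of_few_powers K (p + 1) q) as [c [s' [Hs' [Hc Hsum]]]].
  (* The width is [p + 1] because [q] may equal [2 ^ p]. *)
  { eapply Nat.le_lt_trans; [exact Hq2|]; apply Nat.pow_lt_mono_r; unfold K; nia. }
  rewrite <- Es in Hs'.
  assert (Hs0 : (1 <= s')%nat).
  { destruct s'; [simpl in Hsum; lia | lia]. }
  pose (g := fun u => nsum (fun i => c i * chi (D i u))%nat s').
  assert (Hpow : forall x, (x <= x ^ K)%nat).
  { intros [|x]; [lia|]; unfold K; rewrite Nat.pow_succ_r'.
    pose proof (Nat.pow_nonzero (S x) k ltac:(lia)); nia. }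
  (* Each [g u] is at most the sum of the [c i], hence of the [c i ^ K], which is [q]. *)
  assert (Hgq : forall u, (g u <= q)%nat).
  { intros u; rewrite <- Hsum; apply nsum_le; intros i _.
    specialize (Hpow (c i)); destruct (D i u); cbn [chi]; lia. }
  set (n := nsum (fun u => g u * a u)%nat m).
  assert (Hwt : (nsum g m <= 2 ^ (m + p))%nat).
  { etransitivity; [apply nsum_le_const; intros; apply Hgq|].
    rewrite Nat.pow_add_r; apply Nat.mul_le_mono; [|exact Hq2].
    apply Nat.lt_le_incl, Nat.pow_gt_lin_r; lia. }
  assert (Hn : INR n = rsum (fun u => INR (g u) * INR (a u)) m).
  { unfold n; rewrite INR_nsum; apply rsum_ext; intros; apply mult_INR. }
  assert (Hp0 : forall j, 0 < 2 ^ j) by (intros; apply pow_lt; lra).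
  assert (Herr : forall l, (l <= K)%nat ->
    INR (nsum g m) ^ l * / 2 ^ b' <= / 2 ^ (b + 2)).
  { intros l Hl.
    apply Rle_trans with (2 ^ (K * (m + p)) * / 2 ^ b').
    - apply Rmult_le_compat_r; [left; apply Rinv_0_lt_compat, Hp0|].
      apply Rle_trans with (INR (2 ^ (m + p)) ^ l).
      + apply pow_incr; split; [apply pos_INR | now apply le_INR].
      + rewrite pow2_INR, <- pow_mult; apply Rle_pow; [lra | nia].
    - rewrite Eb, pow_add, Rinv_mult, <- Rmult_assoc, Rinv_r, Rmult_1_l.
      + lra.
      + apply Rgt_not_eq, Hp0. }
  exists n; split; [split|].
  (* A point of the nonempty petal [D 0] supplies a positive term of [n]. *)
  - destruct (HD1 0%nat ltac:(lia)) as [u [Hu HDu]].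
    apply Nat.le_trans with (g u * a u)%nat;
      [|unfold n; apply (nsum_ge_term (fun u => g u * a u)%nat m u Hu)].
    destruct (HA3 u Hu) as [[Ha _] _].
    assert (1 <= g u)%nat; [|nia].
    apply Nat.le_trans with (c 0%nat * chi (D 0%nat u))%nat.
    + rewrite HDu; simpl; specialize (Hc 0%nat ltac:(lia)); lia.
    + apply (nsum_ge_term (fun i => c i * chi (D i u))%nat); lia.
  - etransitivity.
    + apply nsum_le_const; intros u Hu.
      destruct (HA3 u Hu) as [[_ Ha] _].
      apply Nat.mul_le_mono; [etransitivity; [apply Hgq|exact Hq2] | exact Ha].
    + rewrite <- Nat.pow_add_r.
      apply Nat.le_trans with (2 ^ m * 2 ^ (p + (d * S m ^ k + b' + 2) ^ E))%nat.
      * apply Nat.mul_le_mono_r, Nat.lt_le_incl, Nat.pow_gt_lin_r; lia.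
      * rewrite <- Nat.pow_add_r; apply Nat.pow_le_mono_r; lia.
  - intros x Hx e He; rewrite Hn.
    assert (Heps : 0 <= / 2 ^ b') by (left; apply Rinv_0_lt_compat, Hp0).
    assert (Hspec : forall t, (t < m)%nat ->
      forall b, In b (prods (A t) L k) -> forall e, (1 <= e <= k)%nat ->
      near (/ 2 ^ b') (b * INR (a t) ^ e)) by (intros; now apply HA3).
    destruct (Nat.eq_dec e K) as [->|HeK].
    + pose proof (near_top k m L _ a A Heps HA1 HA2 Hspec g m x (le_n m) Hx) as H1.
      fold K in H1.
      (* Disjoint petals give [g u ^ K] no cross terms; exchanging the sums then groups the pure
         powers by petal. *)
      assert (Hdiag : rsum (fun u => INR (g u) ^ K * INR (a u) ^ K) m
        = rsum (fun i => INR (c i ^ K) * W (D i)) s').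
      { transitivity (rsum (fun u => rsum (fun i =>
          INR (c i ^ K) * (INR (chi (D i u)) * INR (a u) ^ K)) s') m).
        - apply rsum_ext; intros u Hu.
          rewrite <- pow_INR; unfold g.
          rewrite pow_disjoint_combination;
            [|unfold K; lia|intros i j Hi Hj Hij; apply HD2; lia].
          rewrite INR_nsum, Rmult_comm, <- rsum_scal; apply rsum_ext; intros i Hi.
          rewrite mult_INR; ring.
        - rewrite rsum_swap; apply rsum_ext; intros i Hi; unfold W.
          apply rsum_scal. }
      rewrite Hdiag in H1.
      (* Replacing every [W (D i)] by [W (D 0)] costs the cell error with total weight [q]. *)
      assert (H2 : near (INR q * / 2 ^ (p + (b + 2)))
        (rsum (fun i => INR (c i ^ K) * (x * W (D i) - x * W (D 0%nat))) s')).
      { rewrite <- Hsum; apply near_weighted_sum; intros i Hi; apply HWD; [lia|exact Hx]. }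
      pose proof (near_add _ _ _ _ (near_add _ _ _ _ H1 H2) (Hq x Hx)) as H.
      match type of H with near ?e ?y => match goal with |- near ?e' ?y' =>
        replace y' with y; [apply (near_le e); [exact H|]|] end end.
      (* Expansion, replacement and Dirichlet each cost at most [/ 2 ^ (b + 2)], together three
         quarters of [/ 2 ^ b]. *)
      * specialize (Herr K (le_n K)).
        assert (INR q * / 2 ^ (p + (b + 2)) <= / 2 ^ (b + 2)).
        { rewrite (pow_add _ p), Rinv_mult, <- Rmult_assoc.
          rewrite <- (Rmult_1_l (/ 2 ^ (b + 2))) at 2.
          apply Rmult_le_compat_r; [left; apply Rinv_0_lt_compat, Hp0|].
          apply (Rmult_le_reg_r (2 ^ p)); [apply Hp0|].
          rewrite Rmult_assoc, Rinv_l by apply Rgt_not_eq, Hp0.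
          rewrite Rmult_1_r, Rmult_1_l, <- pow2_INR; now apply le_INR. }
        assert (Hb2 : / 2 ^ (b + 2) = / 2 ^ b / 4).
        { rewrite pow_add, Rinv_mult; simpl; field; apply Rgt_not_eq, Hp0. }
        pose proof (Rinv_0_lt_compat _ (Hp0 b)).
        lra.
      * rewrite (rsum_ext (fun i => INR (c i ^ K) * (x * W (D i) - x * W (D 0%nat)))
          (fun i => x * (INR (c i ^ K) * W (D i)) + (- (x * W (D 0%nat))) * INR (c i ^ K)))
          by (intros; ring).
        rewrite rsum_add, !rsum_scal, <- INR_nsum, Hsum; ring.
    + eapply near_le;
        [apply (near_lower k m L _ a A HA1 HA2 Hspec g m x e (le_n m) Hx);
         unfold K in *; lia|].
      eapply Rle_trans; [apply Herr; lia | apply pow2_inv_antitone; lia].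
Qed.

Lemma recurrence_exists (k : nat) : exists E, recurrence k E.
Proof.
  induction k as [|k [E HE]].
  - exists 0%nat; intros L b; exists 1%nat; split; [|intros; lia].
    simpl; lia.
  - assert (HB : poly_bounded (fun d b =>
      let K := S k in
      let p := ((b + 2) * d)%nat in
      let t := ((p + (b + 2)) * d + 1)%nat in
      let s := (2 ^ K * (p + 1))%nat in
      let m := (2 * s * t * t + t)%nat in
      let b' := (K * (m + p) + (b + 2))%nat in
      2 * m + p + (d * S m ^ k + b' + 2) ^ E)%nat).
    { cbv zeta.
      assert (HS : forall f, poly_bounded f -> poly_bounded (fun d b => S (f d b))).
      { intros f Hf; destruct (poly_bounded_add f _ Hf (poly_bounded_const 1)) as [e He].
        exists e; intros d b; specialize (He d b); lia. }
      repeat first [apply poly_bounded_const | apply poly_bounded_fst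
        | apply poly_bounded_snd | apply poly_bounded_add | apply poly_bounded_mul
        | apply HS | apply poly_bounded_pow]. }
    destruct HB as [E' HE']; exists E'; intros L b.
    destruct (recurrence_step k E L b HE) as [n [[Hn1 Hn2] Hn]].
    exists n; split; [split; [exact Hn1|]|exact Hn].
    etransitivity; [exact Hn2|]; apply Nat.pow_le_mono_r; [lia|].
    apply (HE' (length L) b).
Qed.

(** * From recurrence to the exponential bound *)

Lemma near_poly_nc (k : nat) (c : nat -> R) (x e : R) :
  (1 <= k)%nat -> (forall i, (1 <= i <= k)%nat -> near e (c i * x ^ i)) ->
  near (INR k * e) (poly_nc k c x).
Proof.
  unfold poly_nc; intros Hk H.
  destruct k as [|k]; [lia|]; clear Hk; simpl pred.
  induction k as [|k IH].
  - simpl sum_f_R0; rewrite Rmult_1_l; apply (H 1%nat); lia.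
  - rewrite S_INR, Rmult_plus_distr_r, Rmult_1_l, tech5.
    apply near_add; [apply IH; intros; apply H; lia | apply H; lia].
Qed.

(** As [f b] is at least [b], the inequality [f b <= x] fails by [b = S x], so it fails for a first
    time. *)
Lemma exists_last_le (f : nat -> nat) (x : nat) :
  (forall b, (b <= f b)%nat) -> (f 0 <= x)%nat -> exists b, (f b <= x < f (S b))%nat.
Proof.
  intros Hf H0.
  assert (H : forall n, (f n <= x)%nat \/ exists b, (f b <= x < f (S b))%nat).
  { induction n as [|n [IH|IH]]; [now left| |now right].
    destruct (Nat.le_gt_cases (f (S n)) x); [now left | right; exists n; lia]. }
  destruct (H (S x)) as [h|h]; [specialize (Hf (S x)); lia | exact h].
Qed.

(* At [x = 0] the library gives [ln 0 = 0], hence [Rpower 0 y = 1]. *)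
Lemma Rpower_root_le (x y : R) (E : nat) :
  (1 <= E)%nat -> 1 <= y -> 0 <= x <= y ^ E -> Rpower x (/ INR E) <= y.
Proof.
  intros HE Hy [Hx0 Hx].
  assert (0 < INR E) by (apply lt_0_INR; lia).
  destruct Hx0 as [Hx0|<-].
  - apply Rle_trans with (Rpower (y ^ E) (/ INR E)).
    + apply Rle_Rpower_l; [left; now apply Rinv_0_lt_compat | split; assumption].
    + rewrite <- Rpower_pow by lra.
      rewrite Rpower_mult, Rinv_r by (apply Rgt_not_eq; assumption).
      rewrite Rpower_1 by lra; apply Rle_refl.
  - unfold Rpower, ln; destruct (Rlt_dec 0 0) as [h|_]; [exfalso; exact (Rlt_irrefl 0 h)|].
    rewrite Rmult_0_r, exp_0; exact Hy.
Qed.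

Lemma ln_le_of_lt_pow2 (N l : nat) : (1 <= N < 2 ^ l)%nat -> ln (INR N) <= INR l.
Proof.
  intros [H1 H2].
  assert (0 < INR N) by (apply lt_0_INR; lia).
  apply lt_INR in H2; rewrite pow2_INR in H2.
  apply ln_increasing in H2; [|assumption].
  rewrite ln_pow in H2 by lra.
  assert (ln 2 <= 1) by (rewrite <- (ln_exp 1); left; apply ln_increasing;
    [lra | pose proof (exp_ineq1 1 ltac:(lra)); lra]).
  pose proof (pos_INR l); nra.
Qed.

Lemma pow_four_ge (k : nat) : (1 <= k)%nat -> INR k + 3 <= 4 ^ k.
Proof.
  induction k as [|[|k] IH]; intros Hk; [lia|simpl; lra|].
  specialize (IH ltac:(lia)); rewrite S_INR, <- tech_pow_Rmult; pose proof (pos_INR (S k)); lra.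
Qed.

(** This is [exp (/ 2) <= 2] raised to the power [b]. *)
Lemma inv_pow2_le_exp (b : nat) : / 2 ^ b <= exp (- (INR b / 2)).
Proof.
  rewrite exp_Ropp; apply Rinv_le_contravar; [apply exp_pos|].
  assert (H : exp (/ 2) <= 2).
  { apply Rsqr_incr_0_var; [|lra]; unfold Rsqr; rewrite <- exp_plus.
    replace (/ 2 + / 2) with 1 by lra; pose proof exp_le_3; lra. }
  induction b as [|b IH].
  - simpl; unfold Rdiv; rewrite Rmult_0_l, exp_0; lra.
  - rewrite S_INR; replace ((INR b + 1) / 2) with (/ 2 + INR b / 2) by field.
    rewrite exp_plus, <- tech_pow_Rmult.
    apply Rmult_le_compat; auto; left; apply exp_pos.
Qed.

(** The denominator is at least [4 * (k + 3) * d], because [4 ^ k] dominates [k + 3] and [E] is at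
    least 4. The summand 1 on the right is repaid later by a factor 3 in the constant. *)
Lemma exponent_bound (k d b E : nat) :
  (1 <= k)%nat -> (1 <= d)%nat -> (4 <= E)%nat ->
  / (4 ^ k * INR (fact k) * INR E * INR d ^ (5 * k)) * (INR (d * k + b + 3))
    <= 1 + INR b / 2.
Proof.
  intros Hk Hd HE.
  assert (H4 := pow_four_ge k Hk).
  assert (HkR : 1 <= INR k) by (apply (le_INR 1); exact Hk).
  assert (HdR : 1 <= INR d) by (apply (le_INR 1); exact Hd).
  assert (HER : 4 <= INR E) by (replace 4 with (INR 4) by (simpl; ring); now apply le_INR).
  assert (Hf : 1 <= INR (fact k)) by (apply (le_INR 1), lt_O_fact).
  assert (Hdp : INR d <= INR d ^ (5 * k)).
  { rewrite <- (pow_1 (INR d)) at 1; apply Rle_pow; [exact HdR | lia]. }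
  pose proof (pos_INR b) as Hb.
  set (M := 4 ^ k * INR (fact k) * INR E * INR d ^ (5 * k)).
  assert (HM : (INR k + 3) * 4 * INR d <= M).
  { unfold M; apply Rmult_le_compat; try lra; try nra.
    apply Rmult_le_compat; try lra; nra. }
  assert (HM0 : 0 < M) by nra.
  apply (Rmult_le_reg_l M); [exact HM0|].
  rewrite <- Rmult_assoc, Rinv_r, Rmult_1_l by lra.
  rewrite !plus_INR, mult_INR; simpl (INR 3).
  assert ((INR k + 3) * 4 * INR d * (1 + INR b / 2) <= M * (1 + INR b / 2)) by
    (apply Rmult_le_compat_r; lra).
  assert (INR k + 3 <= (INR k + 3) * INR d) by nra.
  assert (INR b * 1 <= INR b * ((INR k + 3) * INR d)) by (apply Rmult_le_compat_l; lra).
  nra.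
Qed.

Theorem theorem3 :
  forall k : nat, (1 <= k)%nat ->
  exists D B : R, 1 <= D /\ 0 < B /\
    forall (d : nat) (c : nat -> nat -> R) (N : nat),
      (1 <= d)%nat -> (1 <= N)%nat ->
      exists n : nat, (1 <= n <= N)%nat /\
        forall j : nat, (1 <= j <= d)%nat ->
          dist_nearest_int (poly_nc k (c j) (INR n)) <=
          B * exp (- / (4 ^ k * INR (Factorial.fact k) * D * INR d ^ (5 * k))
                   * Rpower (ln (INR N)) (/ D)).
Proof.
  intros k Hk.
  destruct (recurrence_exists k) as [E0 HE0].
  (* Raising the exponent only weakens the bound on [n]; 4 is what [exponent_bound] asks for. *)
  set (E := (E0 + 4)%nat).
  assert (HE : recurrence k E).
  { intros L b; destruct (HE0 L b) as [n [[H1 H2] H3]]; exists n; split; [split|exact H3].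
    - exact H1.
    - etransitivity; [exact H2|]; apply Nat.pow_le_mono_r; [lia|].
      apply Nat.pow_le_mono_r; unfold E; lia. }
  assert (HE4 : (4 <= E)%nat) by (unfold E; lia).
  clearbody E.
  assert (HkR : 1 <= INR k) by (apply (le_INR 1); exact Hk).
  (* The factor [k] counts the monomials of a polynomial, and 3 exceeds [exp 1]. *)
  exists (INR E), (3 * INR k); split; [|split].
  { apply (le_INR 1); lia. }
  { lra. }
  intros d c N Hd HN.
  set (M := 4 ^ k * INR (fact k) * INR E * INR d ^ (5 * k)).
  assert (HM : 0 < M).
  { unfold M; repeat apply Rmult_lt_0_compat; try apply pow_lt; try lra;
      apply lt_0_INR; try lia; apply lt_O_fact. }
  assert (Hln : 0 <= ln (INR N)).
  { rewrite <- ln_1; destruct HN as [|N HN]; [simpl; lra|].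
    left; apply ln_increasing; [lra | apply (lt_INR 1); lia]. }
  assert (Hmain : forall b : nat, (N < 2 ^ ((d * k + b + 3) ^ E))%nat ->
    exp (Ropp 1) * exp (- (INR b / 2)) <= exp (- / M * Rpower (ln (INR N)) (/ INR E))).
  { intros b Hb; rewrite <- exp_plus.
    assert (Hr : Rpower (ln (INR N)) (/ INR E) <= INR (d * k + b + 3)).
    { apply Rpower_root_le; [lia | apply (le_INR 1); lia | split; [exact Hln|]].
      rewrite <- pow_INR; apply ln_le_of_lt_pow2; lia. }
    pose proof (exponent_bound k d b E Hk Hd HE4) as Hx; fold M in Hx.
    pose proof (Rmult_le_compat_l (/ M) _ _ (Rlt_le _ _ (Rinv_0_lt_compat _ HM)) Hr).
    assert (Hexp : forall x y, x <= y -> exp x <= exp y).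
    { intros x y [h|<-]; [left; now apply exp_increasing | lra]. }
    apply Hexp; lra. }
  assert (He3 : 1 <= 3 * exp (Ropp 1)).
  { rewrite exp_Ropp; apply (Rmult_le_reg_r (exp 1)); [apply exp_pos|].
    rewrite Rmult_assoc, Rinv_l by apply Rgt_not_eq, exp_pos; pose proof exp_le_3; lra. }
  assert (HN2 : (2 ^ Nat.log2 N <= N < 2 ^ S (Nat.log2 N))%nat) by (apply Nat.log2_spec; lia).
  (* The case split asks whether [N] leaves room for recurrence at precision [b = 0]. *)
  destruct (Nat.le_gt_cases ((d * k + 0 + 2) ^ E) (Nat.log2 N)) as [Hbig|Hsmall].
  (* The chosen [b] fits below [N] while [S b] does not; hence the shift from 2 to 3 in [Hmain]. *)
  - destruct (exists_last_le (fun b => (d * k + b + 2) ^ E)%nat (Nat.log2 N)) as [b [Hb1 Hb2]].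
    { intros b; etransitivity; [|apply (Nat.pow_le_mono_r _ 1); lia].
      rewrite Nat.pow_1_r; lia. }
    { exact Hbig. }
    set (L := flat_map (fun j => map (c j) (seq 1 k)) (seq 1 d)).
    assert (HL : length L = (d * k)%nat).
    { unfold L; rewrite (flat_map_constant_length (c := k)).
      - now rewrite length_seq.
      - intros; now rewrite length_map, length_seq. }
    destruct (HE L b) as [n [[Hn1 Hn2] Hn]]; rewrite HL in Hn2.
    exists n; split; [split; [exact Hn1|]|].
    { apply Nat.le_trans with (2 ^ Nat.log2 N)%nat; [|lia].
      etransitivity; [exact Hn2|]; apply Nat.pow_le_mono_r; lia. }
    intros j Hj; fold M.
    apply Rle_trans with (INR k * / 2 ^ b).
    { apply dist_nearest_int_le_near, near_poly_nc; [exact Hk|]; intros i Hi.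
      apply Hn; [|exact Hi]; apply in_flat_map; exists j; split.
      - apply in_seq; lia.
      - apply in_map, in_seq; lia. }
    assert (HNb : (N < 2 ^ ((d * k + b + 3) ^ E))%nat).
    { eapply Nat.lt_le_trans; [apply HN2|]; apply Nat.pow_le_mono_r; [lia|].
      replace (d * k + b + 3)%nat with (d * k + S b + 2)%nat by lia; exact Hb2. }
    specialize (Hmain b HNb).
    pose proof (inv_pow2_le_exp b); pose proof (exp_pos (- (INR b / 2))).
    set (X := exp (- / M * _)) in *.
    assert (exp (- (INR b / 2)) <= 3 * X) by nra.
    nra.
  (* For small [N] the right side is at least 1, so the trivial bound [1 / 2] suffices. *)
  - exists 1%nat; split; [lia|]; intros j _; fold M.
    assert (HNb : (N < 2 ^ ((d * k + 0 + 3) ^ E))%nat).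
    { eapply Nat.lt_le_trans; [apply HN2|]; apply Nat.pow_le_mono_r; [lia|].
      etransitivity; [exact Hsmall|]; apply Nat.pow_le_mono_l; lia. }
    specialize (Hmain 0%nat HNb).
    replace (- (INR 0 / 2)) with 0 in Hmain by (simpl; field); rewrite exp_0 in Hmain.
    pose proof (dist_nearest_int_le_half (poly_nc k (c j) (INR 1))).
    set (X := exp (- / M * _)) in *; nra.
Qed.
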